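(* Let $\mathbbm{k}$ be a field of characteristic not $2$, and let $r, s, n$ be positive integers. If the triple $[r,s,n]$ is admissible over $\mathbbm{k}$, then for every positive integer $m$ the triple $[\,r+\rho(2^{m-1}),\ 2^m s,\ 2^m n\,]$ is admissible over $\mathbbm{k}$, where $\rho$ is the Hurwitz--Radon function.
   Context: Admissible triple: for positive integers $r,s,n$ and a field $\mathbbm{k}$, the triple $[r,s,n]$ is called admissible (over $\mathbbm{k}$) if there is a sums of squares identity $$(x_1^2+x_2^2+\cdots+x_r^2)(y_1^2+y_2^2+\cdots+y_s^2)=z_1^2+z_2^2+\cdots+z_n^2$$ in the polynomial ring $\mathbbm{k}[x_1,\dots,x_r,y_1,\dots,y_s]$, where $x_1,\dots,x_r$ and $y_1,\dots,y_s$ are independent indeterminates and every $z_k$ is a bilinear form in $X=(x_1,\dots,x_r)$ and $Y=(y_1,\dots,y_s)$ with coefficients in $\mathbbm{k}$, i.e. $z_k=\sum_{1\le i\le r,\,1\le j\le s} c_{i,j,k}\,x_i y_j$ with $c_{i,j,k}\in\mathbbm{k}$. Hurwitz--Radon function: for a positive integer $N$, write uniquely $N=2^{4\alpha+\beta}(2\gamma+1)$ with integers $\alpha,\gamma\ge 0$ and $0\le\beta\le 3$; then $\rho(N)=8\alpha+2^{\beta}$. *)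

(* Defs.v *)
From HB Require Import structures.
From mathcomp Require Import all_boot all_order all_algebra.
From mathcomp Require Export mpoly.

Set Implicit Arguments.
Unset Strict Implicit.
Unset Printing Implicit Defensive.

Import GRing.Theory.
Local Open Scope ring_scope.

Section Admissible.

Variables (k : fieldType) (r s : nat).

(* The ring k[x_1, .., x_r, y_1, .., y_s] is {mpoly k[r + s]}: the first r
   indeterminates are the x_i, the last s are the y_j. *)
Definition xvar (i : 'I_r) : {mpoly k[r + s]} := 'X_(lshift s i).
Definition yvar (j : 'I_s) : {mpoly k[r + s]} := 'X_(rshift r j).

Definition bilinear_form (c : 'I_r -> 'I_s -> k) : {mpoly k[r + s]} :=
  \sum_(i < r) \sum_(j < s) c i j *: (xvar i * yvar j).

Definition admissible (n : nat) : Prop :=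
  exists c : 'I_r -> 'I_s -> 'I_n -> k,
    (\sum_(i < r) xvar i ^+ 2) * (\sum_(j < s) yvar j ^+ 2)
    = \sum_(l < n) bilinear_form (fun i j => c i j l) ^+ 2.

End Admissible.

Arguments admissible k r s n : clear implicits.

(* If N = 2 ^ (4 * a + b) * (2 * c + 1) with b <= 3, then 4 * a + b is the
   2-adic valuation of N; see hurwitz_radonE. The value at N = 0 is junk. *)
Definition hurwitz_radon (N : nat) : nat :=
  (8 * (logn 2 N %/ 4) + 2 ^ (logn 2 N %% 4))%N.

Lemma hurwitz_radonE (a b c : nat) : (b <= 3)%N ->
  hurwitz_radon (2 ^ (4 * a + b) * (2 * c + 1)) = (8 * a + 2 ^ b)%N.
Proof.
move=> b3; rewrite /hurwitz_radon.
have -> : logn 2 (2 ^ (4 * a + b) * (2 * c + 1)) = (4 * a + b)%N.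
  rewrite lognM ?expn_gt0 ?addn1 // pfactorK // lognE /= dvdn2 /=.
  by rewrite mul2n odd_double /= addn0.
by rewrite (mulnC 4%N a) divnMDl // modnMDl divn_small // modn_small // addn0.
Qed.

(* Main.v *)
Require Import Defs.
From mathcomp Require Import all_boot all_order all_algebra.
From mathcomp Require Import mxtens.

(** Bilinearity turns a sums of squares identity of type [r, s, n] into a family
    of r matrices A_i of size n x s with A_i^T A_j + A_j^T A_i = 2 delta_ij.
    Given such a family, with a distinguished member A_0, and a family of p
    square matrices B_j of size N, the r + p block matrices
      diag(A_0 (x) 1, - A_0 (x) 1),  diag(A_i (x) 1, A_i (x) 1) for i != 0,
      antidiag(A_0 (x) B_j, A_0 (x) B_j^T)
    satisfy the same relations and have size 2nN x 2sN.  Joining the octonion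
    family [8, 8, 8] repeatedly to the families [2^b, 2^b, 2^b], b <= 3, gives
    the Hurwitz-Radon families [rho(N), N, N] for N = 2^(m - 1), and joining one
    of these to the given family gives the theorem. *)

Set Implicit Arguments.
Unset Strict Implicit.
Unset Printing Implicit Defensive.

Import GRing.Theory.
Local Open Scope ring_scope.

(** * Kronecker products of matrices *)

Section TensorLinearity.

Variables (R : pzRingType) (m n p q : nat).
Implicit Types (A : 'M[R]_(m, n)) (B : 'M[R]_(p, q)).

Lemma tensmxDl A A' B : (A + A') *t B = A *t B + A' *t B.
Proof. by apply/matrixP => i j; rewrite !mxE mulrDl. Qed.

Lemma tensmxDr A B B' : A *t (B + B') = A *t B + A *t B'.
Proof. by apply/matrixP => i j; rewrite !mxE mulrDr. Qed.

End TensorLinearity.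

Lemma tensmx_scalar (R : pzRingType) m n (a b : R) :
  (a%:M : 'M_m) *t (b%:M : 'M_n) = (a * b)%:M.
Proof.
apply/matrixP => i j.
case: (mxtens_indexP i) => i0 i1; case: (mxtens_indexP j) => j0 j1.
rewrite tensmxE !mxE (can_eq (@mxtens_indexK _ _)) xpair_eqE.
by do 2 case: eqP => _; rewrite ?mulr1n ?mulr0n ?mulr0 ?mul0r.
Qed.

(** * Families of matrices satisfying the Hurwitz relations *)

Definition hurwitz_family (R : comNzRingType) r s n
    (A : 'I_r -> 'M[R]_(n, s)) : Prop :=
  forall i j, (A i)^T *m A j + (A j)^T *m A i = ((i == j)%:R *+ 2)%:M.

Definition hurwitz_triple (R : comNzRingType) r s n : Prop :=
  exists A : 'I_r -> 'M[R]_(n, s), hurwitz_family A.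

Section Families.

Variables (R : comNzRingType) (r s n : nat) (A : 'I_r -> 'M[R]_(n, s)).
Hypothesis hA : hurwitz_family A.

Lemma hurwitz_family_map (S : comNzRingType) (f : {rmorphism R -> S}) :
  hurwitz_family (fun i => map_mx f (A i)).
Proof.
move=> i j; rewrite !map_trmx -!map_mxM -map_mxD hA map_scalar_mx.
by rewrite rmorphMn rmorph_nat.
Qed.

Lemma hurwitz_family_anti i j : i != j ->
  (A i)^T *m A j = - ((A j)^T *m A i).
Proof.
by move=> /negPf ne; apply/eqP; rewrite -addr_eq0 hA ne mul0rn raddf0.
Qed.

(** Adding the double sum to itself with the indices exchanged produces the relations termwise, so
    only the diagonal survives. Both sides stay doubled because 2 may be a zero divisor in [R]. *)
Lemma hurwitz_family_sum (x : 'I_r -> R) :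
  ((\sum_i x i *: A i)^T *m (\sum_i x i *: A i)) *+ 2
  = ((\sum_i x i ^+ 2) *+ 2)%:M.
Proof.
set M := \sum_i _.
have E : M^T *m M = \sum_i \sum_j (x i * x j) *: ((A i)^T *m A j).
  have -> : M^T = \sum_i x i *: (A i)^T.
    by rewrite linear_sum; apply: eq_bigr => i _; rewrite linearZ.
  rewrite mulmx_suml; apply: eq_bigr => i _.
  rewrite mulmx_sumr; apply: eq_bigr => j _.
  by rewrite -scalemxAl -scalemxAr scalerA.
rewrite mulr2n {1}E exchange_big E -big_split /= -sumrMnl raddf_sum /=.
apply: eq_bigr => i _; rewrite -big_split /= (bigD1 i) //= big1 => [|j ne].
  rewrite addr0 -scalerDr hA eqxx scale_scalar_mx; congr _%:M.
  by rewrite mulrnAr mulr1.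
rewrite [x i * x j]mulrC -scalerDr hA (negPf ne) mul0rn.
by rewrite raddf0 scaler0.
Qed.

End Families.

Lemma mulr2nI_mx (R : idomainType) m n (M M' : 'M[R]_(m, n)) :
  2%:R != 0 :> R -> M *+ 2 = M' *+ 2 -> M = M'.
Proof.
move=> two E; apply/matrixP => i j; apply: (mulfI two).
by rewrite !mulr_natl -!mulmxnE E.
Qed.

Section Field.

Variable k : fieldType.
Hypothesis char_k : 2 \notin [pchar k].

Lemma two_neq0 : 2%:R != 0 :> k.
Proof. by move: char_k; rewrite inE. Qed.

Lemma hurwitz_family_unit r s n (A : 'I_r -> 'M[k]_(n, s)) i :
  hurwitz_family A -> (A i)^T *m A i = 1%:M.
Proof.
by move=> /(_ i i); rewrite -mulr2n eqxx raddfMn; apply: mulr2nI_mx two_neq0.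
Qed.

(** This relies on the matrices being square: the left inverse B_l^T of B_l is then also a right
    inverse. *)
Lemma hurwitz_family_tr p N (B : 'I_p -> 'M[k]_N) :
  hurwitz_family B -> hurwitz_family (fun i => (B i)^T).
Proof.
move=> hB i j; rewrite !trmxK.
have BTB l : (B l)^T *m B l = 1%:M by apply: hurwitz_family_unit.
have BBT l : B l *m (B l)^T = 1%:M by apply: mulmx1C.
have [<-|ne] := eqVneq i j; first by rewrite BBT -mulr2n raddfMn.
(* B_j (B_i^T B_j) B_j^T is B_j B_i^T, and - B_j (B_j^T B_i) B_j^T is - B_i B_j^T. *)
have E : B j *m ((B i)^T *m B j) *m (B j)^T
         = B j *m (- ((B j)^T *m B i)) *m (B j)^T.
  by rewrite (hurwitz_family_anti hB ne).
move: E; rewrite !mulmxN mulNmx !mulmxA BBT mul1mx -mulmxA BBT mulmx1 => ->.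
by rewrite subrr mul0rn raddf0.
Qed.

Lemma hurwitz_triple_join r s n p N : (0 < r)%N ->
  hurwitz_triple k r s n -> hurwitz_triple k p N N ->
  hurwitz_triple k (r + p) (s * N + s * N) (n * N + n * N).
Proof.
move=> r_gt0 [A hA] [B hB]; pose i0 := Ordinal r_gt0.
have AA i : (A i)^T *m A i = 1%:M by apply: hurwitz_family_unit.
have hBT := hurwitz_family_tr hB.
(* The sign at [i0] makes A_i^T A_0 + A_0^T A'_i vanish for i = i0 as well; for the other i it
   vanishes by anticommutation. *)
pose A' i := (-1) ^+ (i == i0) *: A i.
have hA' : hurwitz_family A'.
  have trA' i : (A' i)^T = (-1) ^+ (i == i0) *: (A i)^T by rewrite linearZ.
  move=> i j; rewrite !trA' /A' -!scalemxAl -!scalemxAr !scalerA.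
  rewrite [X in _ + X *: _]mulrC -scalerDr hA.
  have [->|_] := eqVneq i j; last by rewrite mul0rn raddf0 scaler0.
  by rewrite -signr_addb addbb scale1r.
pose I : 'M[k]_N := 1%:M.
pose C i := block_mx (A i *t I) 0 0 (A' i *t I).
(* With the transpose in one block, corresponding blocks of C_i^T D_j and D_j^T C_i share their
   right tensor factor, so their left factors can be added. *)
pose D j := block_mx 0 (A i0 *t B j) (A i0 *t (B j)^T) 0.
have CC i j : (C i)^T *m C j + (C j)^T *m C i = ((i == j)%:R *+ 2)%:M.
  rewrite !tr_block_mx !mulmx_block add_block_mx !trmx0 !trmx_tens !trmx1.
  rewrite !mul0mx !mulmx0 !addr0 !add0r !tensmx_mul !mulmx1 -!tensmxDl hA hA'.
  by rewrite !tensmx_scalar mulr1 -scalar_mx_block.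
have DD i j : (D i)^T *m D j + (D j)^T *m D i = ((i == j)%:R *+ 2)%:M.
  rewrite !tr_block_mx !mulmx_block add_block_mx !trmx0 !trmx_tens.
  rewrite !mul0mx !mulmx0 !addr0 !add0r !tensmx_mul AA -!tensmxDr hB hBT.
  by rewrite !tensmx_scalar mul1r -scalar_mx_block.
have cross i : (A i)^T *m A i0 + (A i0)^T *m A' i = 0.
  rewrite /A'; case: eqP => [->|/eqP ne].
    by rewrite scaleN1r mulmxN subrr.
  by rewrite scale1r hA (negPf ne) mul0rn raddf0.
have cross' i : (A' i)^T *m A i0 + (A i0)^T *m A i = 0.
  apply: trmx_inj; rewrite linearD /= !trmx_mul trmxK trmx0 addrC.
  by rewrite trmxK cross.
have CD i j : (C i)^T *m D j + (D j)^T *m C i = 0.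
  rewrite !tr_block_mx !mulmx_block add_block_mx !trmx0 !trmx_tens !trmx1 trmxK.
  rewrite !mul0mx !mulmx0 !addr0 !add0r !tensmx_mul !mul1mx !mulmx1 -!tensmxDl.
  by rewrite cross cross' !tens0mx block_mx0.
exists (fun i => match split i with inl a => C a | inr b => D b end) => i j.
case: (split_ordP i) => a ->; case: (split_ordP j) => b ->;
  rewrite ?(unsplitK (inl _)) ?(unsplitK (inr _)) eq_shift.
- exact: CC.
- by rewrite CD mul0rn raddf0.
- by rewrite addrC CD mul0rn raddf0.
- exact: DD.
Qed.

(** * Passage between polynomial identities and matrix families *)

Lemma symmetric_form_eq0 s (S : 'M[k]_s) :
  S^T = S -> (forall y : 'cV_s, y^T *m S *m y = 0) -> S = 0.
Proof.
move=> symS formS.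
have entry a b : (delta_mx a 0 : 'cV_s)^T *m S *m (delta_mx b 0 : 'cV_s)
                 = (S a b)%:M.
  by rewrite trmx_delta -rowE -colE [LHS]mx11_scalar !mxE.
apply/matrixP => a b; rewrite mxE; apply/eqP.
have := formS (delta_mx a 0 + delta_mx b 0).
rewrite [(_ + _)^T]linearD /= !mulmxDl !mulmxDr !formS add0r addr0 !entry.
rewrite -symS mxE symS -raddfD /= => /matrixP/(_ 0 0); rewrite !mxE mulr1n.
by move/eqP; rewrite -mulr2n -mulr_natr mulf_eq0 (negPf two_neq0) orbF.
Qed.

(** The identity is evaluated at points of [k] only. This is enough even for finite [k], since
    polarization, first in y and then in x, needs only basis vectors and their pairwise sums. *)
Lemma hurwitz_triple_admissible r s n :
  admissible k r s n -> hurwitz_triple k r s n.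
Proof.
case=> c id_c; pose A i := \matrix_(l < n, j < s) c i j l.
pose M (x : 'I_r -> k) := \sum_i x i *: A i.
have MM x : (M x)^T *m M x = (\sum_i x i ^+ 2)%:M.
  apply/eqP; rewrite -subr_eq0; apply/eqP; apply: symmetric_form_eq0.
    by rewrite linearB /= trmx_mul trmxK tr_scalar_mx.
  move=> y; pose v i := match split i with inl a => x a | inr b => y b 0 end.
  have vx i : v (lshift s i) = x i by rewrite /v (unsplitK (inl i)).
  have vy j : v (rshift r j) = y j 0 by rewrite /v (unsplitK (inr j)).
  have E : (\sum_i x i ^+ 2) * (\sum_j y j 0 ^+ 2)
           = \sum_l (\sum_i \sum_j c i j l * (x i * y j 0)) ^+ 2.
    have := congr1 (meval v) id_c; rewrite rmorphM !rmorph_sum /=.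
    under eq_bigr => i _ do rewrite rmorphXn /= mevalXU vx.
    under [X in _ * X]eq_bigr => i _ do rewrite rmorphXn /= mevalXU vy.
    move=> ->; apply: eq_bigr => l _; rewrite rmorphXn /= rmorph_sum /=.
    congr (_ ^+ 2); apply: eq_bigr => i _; rewrite rmorph_sum /=.
    by apply: eq_bigr => j _; rewrite mevalZ mevalM !mevalXU vx vy.
  rewrite mulmxBr mulmxBl mul_mx_scalar -scalemxAl mulmxA -mulmxA -trmx_mul.
  apply/matrixP => a b; rewrite !ord1 !mxE; apply/eqP; rewrite subr_eq0.
  have yy : \sum_j y^T 0 j * y j 0 = \sum_j y j 0 ^+ 2.
    by apply: eq_bigr => j _; rewrite mxE.
  rewrite yy E; apply/eqP/eq_bigr => l _; rewrite [X in X * _]mxE -expr2.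
  congr (_ ^+ 2); rewrite mxE exchange_big /=; apply: eq_bigr => j _.
  rewrite summxE mulr_suml; apply: eq_bigr => i _.
  by rewrite !mxE mulrA (mulrC (c i j l)).
(* Polarization in x: [MM] at e_i + e_j, minus [MM] at e_i and at e_j, is the relation for A_i and
   A_j. *)
pose e (i : 'I_r) (l : 'I_r) : k := (l == i)%:R.
have Me i : M (e i) = A i.
  rewrite /M (bigD1 i) //= /e eqxx scale1r big1 ?addr0 // => l /negPf ->.
  by rewrite scale0r.
exists A => i j; rewrite -!Me.
have MD : M (fun l => e i l + e j l) = M (e i) + M (e j).
  by rewrite -big_split; apply: eq_bigr => l _; rewrite scalerDl.
have -> : (i == j)%:R *+ 2 = \sum_l (e i l * e j l) *+ 2.
  rewrite (bigD1 i) //= big1 => [|l /negPf ne].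
    by rewrite addr0 /e eqxx mul1r.
  by rewrite /e ne mul0r mul0rn.
have E := MM (fun l => e i l + e j l); move: E.
under eq_bigr do rewrite sqrrD.
rewrite MD [(_ + _)^T]linearD /= mulmxDl !mulmxDr !MM !big_split /=.
rewrite !(raddfD (@scalar_mx k s)) /= => E.
apply: (addrI (\sum_l e i l ^+ 2)%:M).
by apply: (addIr (\sum_l e j l ^+ 2)%:M); rewrite -E !addrA.
Qed.

(** With Q = sum of x_i A_i over the polynomial ring, a domain where 2 is nonzero, Q^T Q = (sum of
    x_i^2) 1. The forms z_l are the coordinates of Q Y. *)
Lemma admissible_hurwitz_triple r s n :
  hurwitz_triple k r s n -> admissible k r s n.
Proof.
case=> A hA; exists (fun i j l => A i l j).
pose Q := \sum_i xvar k s i *: map_mx (@mpolyC (r + s) k) (A i).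
have two : 2%:R != 0 :> {mpoly k[r + s]}.
  by rewrite -mpolyC_nat mpolyC_eq0 two_neq0.
have QQ : Q^T *m Q = (\sum_i xvar k s i ^+ 2)%:M.
  apply: (mulr2nI_mx two); rewrite -(raddfMn (@scalar_mx _ s)).
  exact: hurwitz_family_sum (hurwitz_family_map hA (@mpolyC (r + s) k)) _.
pose Y : 'cV_s := \col_j yvar k r j.
have QY l : (Q *m Y) l 0 = bilinear_form (fun i j => A i l j).
  rewrite /bilinear_form mxE exchange_big /=; apply: eq_bigr => j _.
  rewrite summxE mulr_suml; apply: eq_bigr => i _.
  by rewrite !mxE -mul_mpolyC mulrAC mulrC mulrA.
have : (Q *m Y)^T *m (Q *m Y) = (\sum_i xvar k s i ^+ 2) *: (Y^T *m Y).
  by rewrite trmx_mul -mulmxA [Q^T *m _]mulmxA QQ mul_scalar_mx -scalemxAr.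
move=> /matrixP/(_ 0 0); rewrite !mxE => E.
under eq_bigr => j _ do rewrite expr2.
transitivity ((\sum_i xvar k s i ^+ 2) * \sum_j Y^T 0 j * Y j 0).
  by congr (_ * _); apply: eq_bigr => j _; rewrite !mxE expr2.
rewrite -E; apply: eq_bigr => l _.
by rewrite [(_)^T _ _]mxE QY expr2.
Qed.

End Field.

(** * Octonion and Hurwitz-Radon families *)

(* The coefficient of e_l in e_x e_y, for the octonions as a twisted group
   algebra of (Z/2)^3: indices are read in binary, and e_x e_y is +- e_(x xor y)
   with the sign (-1)^f(x,y), where f is the cubic form of Albuquerque and
   Majid. The indices below 1, 2, 4 span the reals, the complex numbers and the
   quaternions. *)
Definition octonion_mul (x l y : nat) : int :=
  let x0 := odd x in let x1 := odd x./2 in let x2 := odd x./2./2 in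
  let y0 := odd y in let y1 := odd y./2 in let y2 := odd y./2./2 in
  if [&& odd l == x0 (+) y0, odd l./2 == x1 (+) y1 & odd l./2./2 == x2 (+) y2]
  then if x0 && (y0 (+) y1 (+) y2) (+) x1 && (y1 (+) y2) (+) x2 && y2
          (+) [&& y0, x1 & x2] (+) [&& x0, y1 & x2] (+) [&& x0, x1 & y2]
       then -1 else 1
  else 0.

(** The entrywise relations over the integers, written with lists so that they can be decided by
    computation. *)
Definition octonion_check (N : nat) : bool :=
  all (fun i => all (fun i' => all (fun j => all (fun j' =>
    foldr +%R 0 [seq octonion_mul i l j * octonion_mul i' l j'
      + octonion_mul i' l j * octonion_mul i l j' | l <- iota 0 N]
    == (i == i')%:R *+ 2 *+ (j == j'))
  (iota 0 N)) (iota 0 N)) (iota 0 N)) (iota 0 N).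

Lemma hurwitz_triple_octonion (R : comNzRingType) d : (d <= 3)%N ->
  hurwitz_triple R (2 ^ d) (2 ^ d) (2 ^ d).
Proof.
move=> d3; have : octonion_check (2 ^ d).
  by case: d d3 => [|[|[|[|d]]]]; last (by []); move=> _; vm_compute.
move: (2 ^ d)%N => N check.
pose A (i : 'I_N) : 'M[int]_N := \matrix_(l, j) octonion_mul i l j.
suff hA : hurwitz_family A.
  by eexists; exact: (hurwitz_family_map hA (intmul 1 : int -> R)).
move=> i i'; apply/matrixP => j j'; rewrite !mxE.
have mem (a : 'I_N) : nat_of_ord a \in iota 0 N by rewrite mem_iota /=.
move: check => /allP/(_ _ (mem i))/allP/(_ _ (mem i')).
move=> /allP/(_ _ (mem j))/allP/(_ _ (mem j'))/eqP.
rewrite foldrE big_map -{1}(subn0 N) -/(index_iota 0 N) big_mkord => <-.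
by rewrite -big_split; apply: eq_bigr => l _; rewrite !mxE.
Qed.

(** Each join with [8, 8, 8] adds 8 members and multiplies the size by 2 * 8 = 2^4, which is the
    recursion of rho when the exponent grows by 4. *)
Lemma hurwitz_radon_triple (k : fieldType) e : 2 \notin [pchar k] ->
  hurwitz_triple k (hurwitz_radon (2 ^ e)) (2 ^ e) (2 ^ e).
Proof.
move=> char_k; rewrite /hurwitz_radon pfactorK // {3 4}(divn_eq e 4).
have : (e %% 4 <= 3)%N by rewrite -ltnS ltn_pmod.
move: (e %/ 4)%N (e %% 4)%N => q d d3.
elim: q => [|q IHq]; first exact: hurwitz_triple_octonion.
have := hurwitz_triple_join char_k _ (@hurwitz_triple_octonion k 3 _) IHq.
have -> : (2 ^ (q.+1 * 4 + d) = 2 ^ 3 * 2 ^ (q * 4 + d) * 2)%N.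
  by rewrite mulSn -addnA !expnD mulnAC.
by rewrite muln2 -addnn (mulnS 8) -addnA; apply.
Qed.

Local Close Scope ring_scope.

Theorem mainTheorem1 (k : fieldType) (char_k : 2 \notin [pchar k]%R)
    (r s n : nat) (r_gt0 : 0 < r) (s_gt0 : 0 < s) (n_gt0 : 0 < n) :
  admissible k r s n ->
  forall m : nat, 0 < m ->
    admissible k (r + hurwitz_radon (2 ^ m.-1)) (2 ^ m * s) (2 ^ m * n).
Proof.
move=> adm [//|m] _ /=; apply: admissible_hurwitz_triple => //.
(* The exponent is now [m.+1]: the joined family has size 2^m, and the two diagonal blocks supply
   the last factor 2. *)
have pow t : 2 ^ m.+1 * t = t * 2 ^ m + t * 2 ^ m.
  by rewrite expnS mulnC mulnCA mul2n -addnn.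
rewrite !pow; apply: hurwitz_triple_join => //.
  exact: hurwitz_triple_admissible.
exact: hurwitz_radon_triple.
Qed.
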